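(* Let $X,Y$ be function spaces in the wide sense on $(\Omega,\Sigma,\mu,\Delta_X)$ and $(\Omega,\Sigma,\mu,\Delta_Y)$ respectively, and let $i:X\to Y$ be an absolutely continuous (bounded linear) injection with dense range. Suppose that $i(\Delta_X)=\Delta_Y$, i.e. $i(\Delta_X(A,f))=\Delta_Y(A,i(f))$ for all $A\in\Sigma$, $f\in X$. Then for all $0<\theta<\beta<1$ and all $1<p<+\infty$ the canonical injection $i:(X,Y)_{\theta,p}\to(X,Y)_{\beta,p}$ is absolutely continuous.
   Context: All Banach spaces are complex; $(\Omega,\Sigma,\mu)$ is a measure space. A Banach space $Y$ is a function space in the wide sense on $(\Omega,\Sigma,\mu,\Delta_Y)$ if $\Delta_Y:\Sigma\times Y\to Y$ satisfies: (I) $\Delta_Y(A\cap B,f)=\Delta_Y(A,\Delta_Y(B,f))$ for all $A,B\in\Sigma$, $f\in Y$; (II) $f\mapsto\Delta_Y(A,f)$ is linear for each $A\in\Sigma$; (III) $\Delta_Y(A\cup B,f)=\Delta_Y(A,f)+\Delta_Y(B,f)$ if $A\cap B=\emptyset$; (IV) $\Delta_Y(A,f)=0$ if $\mu(A)=0$, and $\Delta_Y(\Omega,f)=f$; (V) there is $C>0$ with $\|\Delta_Y(A,f)\|\le C\|f\|$ for all $A,f$. A bounded operator $T:X\to Z$ from a function space in the wide sense $X$ to a Banach space $Z$ is absolutely continuous if for every $\varepsilon>0$ there is $\delta>0$ such that for every $A\in\Sigma$ with $\mu(A)<\delta$, the operator $f\mapsto T(\Delta_X(A,f))$ has norm $<\varepsilon$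 in $\mathcal L(X,Z)$. Via $i$, $X$ is identified with a subspace of $Y$ and $(X,Y)$ is an interpolation couple with $X+Y=Y$. The real interpolation space is $(X,Y)_{\theta,p}=\{a\in X+Y:\|a\|_{\theta,p}=[\int_0^\infty(K(a,t)/t^\theta)^p\,dt/t]^{1/p}<\infty\}$ with $K(a,t)=\inf\{\|a_0\|_X+t\|a_1\|_Y:a=a_0+a_1,\ a_0\in X,\ a_1\in Y\}$. It is a function space in the wide sense on $(\Omega,\Sigma,\mu,\Delta_{\theta,p})$, where $\Delta_{\theta,p}$ is the restriction of $\Delta_Y$ to $\Sigma\times(X,Y)_{\theta,p}$. For $\theta<\beta$ one has $(X,Y)_{\theta,p}\subset(X,Y)_{\beta,p}$ continuously. *)

(* Defs.v *)
From HB Require Import structures.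
From mathcomp Require Import all_boot all_order all_algebra.
From mathcomp Require Import complex.
From mathcomp Require Import all_classical all_reals all_analysis.

Set Implicit Arguments.
Unset Strict Implicit.
Unset Printing Implicit Defensive.

Import Order.TTheory GRing.Theory Num.Theory.
Import numFieldNormedType.Exports.

Local Open Scope classical_set_scope.
Local Open Scope complex_scope.
Local Open Scope ring_scope.

Section RealNorm.
Context {R : realType} {V : normedModType R[i]}.

(* The library norm of a complex normed space takes values in R[i]; it is
   nonnegative, so its real part carries all the information. *)
Definition rnorm (f : V) : R := complex.Re `|f|.

Definition ernorm (f : V) : \bar R := (rnorm f)%:E.

End RealNorm.

Section WideSense.
Context {R : realType} {d : measure_display} {T : measurableType d}.

(* Y is a function space in the wide sense on (T, measurable, mu, Delta);
   Delta is a total function of the set, constrained on measurable sets only. *)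
Record wide_function_space (mu : {measure set T -> \bar R})
    (Y : completeNormedModType R[i]) (Delta : set T -> Y -> Y) : Prop := {
  wfs_setI : forall (A B : set T) (f : Y), measurable A -> measurable B ->
    Delta (A `&` B) f = Delta A (Delta B f) ;
  wfs_linear : forall A : set T, measurable A -> linear (Delta A) ;
  wfs_setU : forall (A B : set T) (f : Y), measurable A -> measurable B ->
    A `&` B = set0 -> Delta (A `|` B) f = Delta A f + Delta B f ;
  wfs_null : forall (A : set T) (f : Y), measurable A -> mu A = 0%E ->
    Delta A f = 0 ;
  wfs_setT : forall f : Y, Delta setT f = f ;
  wfs_bounded : exists2 C : R, 0 < C &
    forall (A : set T) (f : Y), measurable A ->
      rnorm (Delta A f) <= C * rnorm f }.

End WideSense.

(* A normed space sitting inside a complex vector space V is given by an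
   extended-real-valued norm N on V; the space is {f | N f < +oo}. A complex
   normed space itself corresponds to N := ernorm. *)
Section AbsoluteContinuity.
Context {R : realType}.

Definition bounded_operator (V W : lmodType R[i]) (NV : V -> \bar R)
    (NW : W -> \bar R) (u : V -> W) : Prop :=
  linear u /\
  exists M : R, forall f : V, (NV f < +oo)%E -> (NW (u f) <= M%:E * NV f)%E.

Definition operator_norm (V W : lmodType R[i]) (NV : V -> \bar R)
    (NW : W -> \bar R) (u : V -> W) : \bar R :=
  ereal_sup [set NW (u f) | f in [set f : V | (NV f <= 1)%E]].

Definition absolutely_continuous (d : measure_display) (T : measurableType d)
    (mu : {measure set T -> \bar R}) (V W : lmodType R[i])
    (NV : V -> \bar R) (Delta : set T -> V -> V) (NW : W -> \bar R)
    (u : V -> W) : Prop :=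
  bounded_operator NV NW u /\
  forall eps : R, 0 < eps -> exists2 delta : R, 0 < delta &
    forall A : set T, measurable A -> (mu A < delta%:E)%E ->
      (operator_norm NV NW (fun f => u (Delta A f)) < eps%:E)%E.

End AbsoluteContinuity.

Section RealInterpolation.
Context {R : realType} {X Y : normedModType R[i]}.

(* X is regarded as a subspace of Y through i, so that X + Y = Y. *)
Definition K_functional (i : X -> Y) (a : Y) (t : R) : R :=
  inf [set s : R | exists (a0 : X) (a1 : Y),
    a = i a0 + a1 /\ s = rnorm a0 + t * rnorm a1].

(* The interpolation space (X, Y)_{theta,p} is the set of all a : Y at which
   this norm is < +oo. *)
Definition interpolation_norm (i : X -> Y) (theta p : R) (a : Y) : \bar R :=
  ((\int[lebesgue_measure]_(t in `]0%R, +oo[)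
     (((K_functional i a t / t `^ theta) `^ p) / t)%:E) `^ p^-1)%E.

End RealInterpolation.

(* Main.v *)
Require Import Defs.
From HB Require Import structures.
From mathcomp Require Import all_boot all_order all_algebra.
From mathcomp Require Import complex.
From mathcomp Require Import ring lra.
From mathcomp Require Import all_classical all_reals all_analysis.
From mathcomp Require Import measurable_realfun.

(** Write [K(a, t)] for the K-functional. If [D] is the operator [Delta_Y(A, .)]
    and [C] bounds [Delta_X] and [Delta_Y], applying [D] to both terms of a
    decomposition gives [K(D a, t) <= C K(a, t)]. If moreover [D o i] has norm at
    most [e], the trivial decomposition [D a = 0 + D a] gives
    [K(D a, t) <= t e K(a, C / e)]. In the integral defining [||D a||_(beta,p)],
    the first estimate is used for [t > N], where it gains the factor
    [N ^ (theta - beta)], and the second one for [t <= N], where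
    [K(a, s) <= c s ^ theta ||a||_(theta,p)], a consequence of the monotonicity of
    [K(a, .)], yields a bound of order [e ^ (1 - theta) N ^ (1 - beta)]. *)

Import Order.TTheory GRing.Theory Num.Theory.
Import numFieldNormedType.Exports.

Local Open Scope classical_set_scope.
Local Open Scope complex_scope.
Local Open Scope ring_scope.

(** * Real-valued norms on complex normed spaces *)

Section RealNormTheory.
Context {R : realType} {V : normedModType R[i]}.
Implicit Types (f g : V).

Lemma rnormE f : (rnorm f)%:C = `|f|.
Proof. by rewrite /rnorm RRe_real// ger0_real. Qed.

Lemma rnorm_ge0 f : 0 <= rnorm f.
Proof. by have := normr_ge0 f; rewrite -rnormE (lecR 0). Qed.

Lemma rnorm0 : rnorm (0 : V) = 0.
Proof. by rewrite /rnorm normr0. Qed.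

Lemma rnorm_eq0 f : rnorm f = 0 -> f = 0.
Proof. by move=> f0; apply/normr0_eq0; rewrite -rnormE f0. Qed.

Lemma ler_rnormD f g : rnorm (f + g) <= rnorm f + rnorm g.
Proof. by rewrite -lecR rmorphD /= !rnormE ler_normD. Qed.

Lemma rnormZ (r : R) f : 0 <= r -> rnorm (r%:C *: f) = r * rnorm f.
Proof.
move=> r0; apply: complexI; rewrite rnormE normrZ rmorphM /= rnormE.
by rewrite ger0_norm // (lecR 0).
Qed.

End RealNormTheory.

(** * Bounds and monotonicity for the K-functional *)

Section KFunctional.
Context {R : realType} {X Y : normedModType R[i]}.
Variable i : X -> Y.
Implicit Types s t : R.

Lemma K_functional_le a t (a0 : X) (a1 : Y) : 0 <= t -> a = i a0 + a1 ->
  K_functional i a t <= rnorm a0 + t * rnorm a1.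
Proof.
move=> t0 ->; apply: ge_inf; last by exists a0, a1.
by exists 0 => _ [b0 [b1 [_ ->]]]; rewrite addr_ge0 ?mulr_ge0 ?rnorm_ge0.
Qed.

(** The real [inf] of an empty set would be 0; the decomposition [a = i 0 + (a - i 0)] shows that
    the set is never empty. *)
Lemma le_K_functional a t x :
  (forall a0 a1, a = i a0 + a1 -> x <= rnorm a0 + t * rnorm a1) ->
  x <= K_functional i a t.
Proof.
move=> h; apply: lb_le_inf; last by move=> _ [a0 [a1 [/h ? ->]]].
by exists (rnorm (0 : X) + t * rnorm (a - i 0)), 0, (a - i 0); rewrite addrC subrK.
Qed.

Lemma K_functional_ge0 a t : 0 <= t -> 0 <= K_functional i a t.
Proof.
move=> t0; apply: le_K_functional => a0 a1 _.
by rewrite addr_ge0 ?mulr_ge0 ?rnorm_ge0.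
Qed.

Lemma K_functional_nondecreasing a s t : 0 <= s -> s <= t ->
  K_functional i a s <= K_functional i a t.
Proof.
move=> s0 st; apply: le_K_functional => a0 a1 aE.
apply: le_trans (K_functional_le _ _ a0 a1 s0 aE) _.
by rewrite lerD2l ler_wpM2r// rnorm_ge0.
Qed.

(** Dividing by [c] reduces this to a lower bound for the infimum. Separate times [t] and [s] are
    allowed because one of the two estimates for [D a] evaluates the K-functional of [a] at a fixed
    time. *)
Lemma K_functional_scale_le a b t s (c : R) : 0 < c ->
  (forall a0 a1, a = i a0 + a1 ->
    K_functional i b t <= c * (rnorm a0 + s * rnorm a1)) ->
  K_functional i b t <= c * K_functional i a s.
Proof.
move=> c0 h; rewrite -ler_pdivrMl//; apply: le_K_functional => a0 a1 /h.
by rewrite ler_pdivrMl.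
Qed.

End KFunctional.

(** * Measurability and integrals of weighted powers *)

Section PowerIntegral.
Context {R : realType}.
Local Notation mu := (@lebesgue_measure R).

(** Monotonicity is the source of measurability for the K-functional. It is known for nonnegative
    arguments only, so [k] is first replaced by [k (max x 0)], which is monotone on the whole line
    and equal to [k] on [D]. *)
Lemma measurable_nondecreasing_pos (k : R -> R) (D : set R) : measurable D ->
  D `<=` [set x | 0 <= x] ->
  (forall s t, 0 <= s -> s <= t -> k s <= k t) -> measurable_fun D k.
Proof.
move=> mD D0 knd.
apply: (@eq_measurable_fun _ _ _ _ D (fun x => k (Num.max x 0))) => [x|].
  by rewrite inE => /D0/= x0; rewrite max_l.
apply: nondecreasing_measurable => // s t st; apply: knd.
  by rewrite le_max lexx orbT.
by rewrite ge_max !le_max st lexx orbT.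
Qed.

Lemma interpolation_integrandE (x t theta p : R) : 0 <= x -> 0 < t ->
  (x / t `^ theta) `^ p / t = x `^ p * t `^ (- (theta * p) - 1).
Proof.
move=> x0 t0; rewrite powRM ?invr_ge0 ?powR_ge0// -powRN -powRrM mulNr.
by rewrite powRD ?(gt_eqF t0) ?implybT// powR_inv1 ?ltW// mulrA.
Qed.

Lemma measurable_interpolation_integrand (k : R -> R) (theta p : R) (D : set R) :
  measurable D -> D `<=` [set x | 0 < x] ->
  (forall t, 0 <= t -> 0 <= k t) ->
  (forall s t, 0 <= s -> s <= t -> k s <= k t) ->
  measurable_fun D (fun t => ((k t / t `^ theta) `^ p / t)%:E).
Proof.
move=> mD D0 k0 knd; apply/measurable_EFinP.
apply: (@eq_measurable_fun _ _ _ _ D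
    (fun t => k t `^ p * t `^ (- (theta * p) - 1))) => [t|].
  by rewrite inE => /D0/= t0; rewrite interpolation_integrandE ?k0 ?ltW.
apply: measurable_funM; last exact: (measurable_funS measurableT).
apply: (measurableT_comp (measurable_powR _)).
by apply: measurable_nondecreasing_pos => // t /D0 /ltW.
Qed.

(** The integrand may be singular at 0. The interval is exhausted by the compact intervals [F n], on
    which the fundamental theorem of calculus applies with primitive [t ^ a / a], and monotone
    convergence gives the limit. *)
Lemma integral_powR_le (a c : R) : 0 < a -> 0 < c ->
  (\int[mu]_(t in `]0%R, c]) (t `^ (a - 1))%:E <= (c `^ a / a)%:E)%E.
Proof.
move=> a0 c0.
pose F (n : nat) : set R := `[n.+1%:R^-1, c]%classic.
have F0 n x : F n x -> 0 < x.
  by rewrite /F/= in_itv/= => /andP[+ _]; apply: lt_le_trans.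
have -> : `]0, c]%classic = \bigcup_n F n.
  apply/seteqP; split => [x|x [n _ Fx]]; last first.
    by have := F0 _ _ Fx; move: Fx; rewrite /F/= !in_itv/= => /andP[_ ->] ->.
  rewrite /= in_itv/= => /andP[x0 xc].
  have [n _ nx] := near_infty_natSinv_lt (PosNum x0).
  exists n => //; rewrite /F/= in_itv/= xc andbT.
  exact/ltW/(nx n (leqnn n)).
have mf D : measurable D -> measurable_fun D (fun t => (t `^ (a - 1))%:E).
  move=> mD; apply/measurable_EFinP.
  exact: (measurable_funS measurableT).
have cv : (\int[mu]_(t in F n) (t `^ (a - 1))%:E @[n --> \oo] -->
    \int[mu]_(t in \bigcup_n F n) (t `^ (a - 1))%:E)%E.
  apply: ge0_nondecreasing_set_cvg_integral.
  - move=> n m nm; apply/subsetPset => x.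
    rewrite /F/= !in_itv/= => /andP[h ->]; rewrite andbT; apply: le_trans h.
    by rewrite lef_pV2 ?posrE// ler_nat.
  - by move=> n; exact: measurable_itv.
  - by move=> n; apply: mf; exact: measurable_itv.
  - by move=> n x _; rewrite lee_fin powR_ge0.
rewrite -(cvg_lim _ cv)//.
apply: lime_le; first by apply/cvg_ex; eexists; exact: cv.
near=> n.
have nc : n.+1%:R^-1 < c by near: n; exact: (near_infty_natSinv_lt (PosNum c0)).
have dF (x : R) : 0 < x -> is_derive x 1 (fun t => a^-1 * t `^ a) (x `^ (a - 1)).
  move=> x0; have := is_derive1_powR a x0 => dx.
  apply: is_derive_eq; rewrite /GRing.scale/= mulrA mulVf ?gt_eqF// mul1r//.
have cP (q x : R) : 0 < x -> {for x, continuous (fun t : R => t `^ q)}.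
  move=> x0; apply/differentiable_continuous/derivable1_diffP.
  by apply: derivable_powR; rewrite in_itv/= x0.
have cF (x : R) : 0 < x -> {for x, continuous (fun t => a^-1 * t `^ a)}.
  by move=> x0; apply: cvgM; [exact: cvg_cst|exact: cP].
rewrite (@continuous_FTC2 _ _ (fun t => a^-1 * t `^ a))//.
(* The boundary term at the left end is nonnegative and is dropped. *)
- rewrite -EFinB lee_fin mulrC -[leRHS]subr0 lerB//.
  by rewrite mulr_ge0 ?powR_ge0 ?invr_ge0 ?ltW.
- apply: continuous_in_subspaceT => x; rewrite inE => xF.
  exact/cP/(F0 n).
- split.
  + move=> x; rewrite in_itv/= => /andP[nx _].
    have x0 : 0 < x by apply: lt_trans nx.
    by have := dF _ x0 => -[].
  + apply: cvg_at_right_filter; exact: cF.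
  + apply: cvg_at_left_filter; exact: cF.
- move=> x; rewrite in_itv/= => /andP[nx _].
  have x0 : 0 < x by apply: lt_trans nx.
  by rewrite derive1E; have := dF _ x0 => ?; rewrite derive_val.
Unshelve. all: by end_near. Qed.

(** For [k] the K-functional of [a] and [p > 0], this is the [p]-th power of the interpolation norm
    of [a]. A general [k] is allowed since the estimates use only sign and monotonicity. *)
Definition interpolation_integral (k : R -> R) (theta p : R) : \bar R :=
  (\int[mu]_(t in `]0%R, +oo[) (((k t / t `^ theta) `^ p) / t)%:E)%E.

Lemma ler_powRN (q x y : R) : 0 <= q -> 0 < x -> x <= y ->
  y `^ (- q) <= x `^ (- q).
Proof.
move=> q0 x0 xy; have y0 := lt_le_trans x0 xy.
rewrite !powRN lef_pV2 ?posrE ?powR_gt0//.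
by apply: ge0_ler_powR => //; rewrite nnegrE ltW.
Qed.

Lemma interpolation_integrand_ge0 (k : R -> R) (theta p t : R) : 0 < t ->
  (0 <= ((k t / t `^ theta) `^ p / t)%:E)%E.
Proof. by move=> t0; rewrite lee_fin mulr_ge0 ?powR_ge0// invr_ge0 ltW. Qed.

(** * Comparison of interpolation integrals with different exponents *)

Section Estimates.
Context {k : R -> R} {p : R}.
Hypotheses (k0 : forall t, 0 <= t -> 0 <= k t)
  (knd : forall s t, 0 <= s -> s <= t -> k s <= k t) (p0 : 0 < p).

(** Only the interval from [s] to [2 * s] is kept. There [k t] is at least [k s], the decreasing
    power of [t] is at least its value at [2 * s], and the length [s] cancels one inverse power of
    [s]. This is the pointwise bound on [k s] by [s ^ theta] times the norm. *)
Lemma interpolation_integral_ge (theta s : R) : 0 < theta -> 0 < s ->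
  ((k s `^ p * (s `^ (- (theta * p)) * 2 `^ (- (theta * p) - 1)))%:E <=
    interpolation_integral k theta p)%E.
Proof.
move=> th0 s0; rewrite /interpolation_integral.
have s2 : s < 2 * s by lra.
have s0' := ltW s0; have p0' := ltW p0.
have sub : `[s, 2 * s] `<=` `]0%R, +oo[.
  by move=> x/=; rewrite !in_itv/= andbT => /andP[+ _]; apply: lt_le_trans.
have pos : `]0%R, +oo[ `<=` [set x : R | 0 < x].
  by move=> x/=; rewrite in_itv/= andbT.
apply: (@le_trans _ _ (\int[mu]_(t in `[s, (2 * s)%R])
    cst (k s `^ p * (2 * s) `^ (- (theta * p) - 1))%:E t)%E).
  rewrite integral_cst//= lebesgue_measure_itv/= lte_fin s2 -EFinB -EFinM.
  rewrite lee_fin powRM// [s `^ (_ - 1)]powRD ?(gt_eqF s0) ?implybT//.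
  rewrite powR_inv1// le_eqVlt; apply/orP; left; apply/eqP.
  by field; rewrite gt_eqF.
apply: (@le_trans _ _ (\int[mu]_(t in `[s, (2 * s)%R])
    ((k t / t `^ theta) `^ p / t)%:E)%E); last first.
  apply: ge0_subset_integral => //.
    exact: measurable_interpolation_integrand.
  by move=> x /pos /= x0; exact: interpolation_integrand_ge0.
apply: ge0_le_integral => //=.
- by move=> x _; rewrite lee_fin mulr_ge0 ?powR_ge0.
- apply: measurable_interpolation_integrand => //.
  exact: subset_trans pos.
- move=> x xs; have x0 : 0 < x by have := sub _ xs; rewrite /= in_itv/= andbT.
  move: xs; rewrite /= in_itv/= => /andP[sx xs2].
  have x0' := ltW x0.
  rewrite lee_fin interpolation_integrandE ?k0//.
  apply: ler_pM; rewrite ?powR_ge0//.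
    by apply: ge0_ler_powR; rewrite ?nnegrE ?k0 ?knd.
  by rewrite -opprD ler_powRN// addr_ge0// mulr_ge0 ?ltW.
Qed.

Context {h : R -> R}.
Hypotheses (h0 : forall t, 0 <= t -> 0 <= h t)
  (hnd : forall s t, 0 <= s -> s <= t -> h s <= h t).

(** Here [k] and [h] stand for the K-functionals of [a] and [D a]. Changing [theta] to [beta]
    multiplies the integrand by [t ^ (- ((beta - theta) * p))], which for [t > N] is at most its
    value at [N]. *)
Lemma interpolation_integral_tail (theta beta C N : R) :
  theta < beta -> 0 < C -> 0 < N -> (forall t, 0 < t -> h t <= C * k t) ->
  (\int[mu]_(t in `]N, +oo[) ((h t / t `^ beta) `^ p / t)%:E <=
    (C `^ p * N `^ (- ((beta - theta) * p)))%:E *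
      interpolation_integral k theta p)%E.
Proof.
move=> tb C0 N0 hk; rewrite /interpolation_integral.
have sub : `]N, +oo[ `<=` `]0%R, +oo[.
  by move=> x/=; rewrite !in_itv/= !andbT; apply: lt_trans.
have pos : `]0%R, +oo[ `<=` [set x : R | 0 < x].
  by move=> x/=; rewrite in_itv/= andbT.
have posN := subset_trans sub pos.
have c0 : 0 <= C `^ p * N `^ (- ((beta - theta) * p)).
  by rewrite mulr_ge0 ?powR_ge0.
apply: (@le_trans _ _ ((C `^ p * N `^ (- ((beta - theta) * p)))%:E *
  \int[mu]_(t in `]N, +oo[) ((k t / t `^ theta) `^ p / t)%:E)%E); last first.
  apply: lee_wpmul2l; first by rewrite lee_fin.
  apply: ge0_subset_integral => //.
    exact: measurable_interpolation_integrand.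
  by move=> x /pos /= x0; exact: interpolation_integrand_ge0.
rewrite -ge0_integralZl//; last 2 first.
- exact: measurable_interpolation_integrand.
- by move=> x /posN /= x0; exact: interpolation_integrand_ge0.
apply: ge0_le_integral => //.
- by move=> x /posN /= x0; exact: interpolation_integrand_ge0.
- exact: measurable_interpolation_integrand.
- by apply: measurable_funeM; exact: measurable_interpolation_integrand.
- move=> x /=; rewrite in_itv/= andbT => Nx; have x0 := lt_trans N0 Nx.
  have x0' := ltW x0; have C0' := ltW C0; have p0' := ltW p0.
  rewrite -EFinM lee_fin !interpolation_integrandE ?k0 ?h0//.
  have -> : - (beta * p) - 1 = - ((beta - theta) * p) + (- (theta * p) - 1) by ring.
  rewrite powRD ?(gt_eqF x0) ?implybT// [leLHS]mulrA [leRHS]mulrACA [leRHS]mulrA.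
  rewrite ler_wpM2r ?powR_ge0//; apply: ler_pM;
    rewrite ?mulr_ge0 ?powR_ge0//.
    rewrite -powRM ?k0//; apply: ge0_ler_powR;
      by rewrite ?nnegrE ?mulr_ge0 ?h0 ?k0 ?hk.
  by rewrite ler_powRN ?mulr_ge0 ?subr_ge0// ltW.
Qed.

(** The linear bound on [h] leaves [c ^ p * t ^ ((1 - beta) * p - 1)], which is integrable at 0
    because [beta < 1]. *)
Lemma interpolation_integral_head (beta c N : R) :
  beta < 1 -> 0 <= c -> 0 < N -> (forall t, 0 < t -> h t <= t * c) ->
  (\int[mu]_(t in `]0%R, N]) ((h t / t `^ beta) `^ p / t)%:E <=
    (c `^ p * (N `^ ((1 - beta) * p) / ((1 - beta) * p)))%:E)%E.
Proof.
move=> b1 c0 N0 hc.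
have pos : `]0%R, N] `<=` [set x : R | 0 < x].
  by move=> x/=; rewrite in_itv/= => /andP[].
have a0 : 0 < (1 - beta) * p by rewrite mulr_gt0 ?subr_gt0.
rewrite EFinM; apply: (@le_trans _ _ ((c `^ p)%:E *
  \int[mu]_(t in `]0%R, N]) (t `^ ((1 - beta) * p - 1))%:E)%E); last first.
  by apply: lee_wpmul2l; rewrite ?lee_fin ?powR_ge0// integral_powR_le.
have mp : measurable_fun `]0%R, N] (fun t => (t `^ ((1 - beta) * p - 1))%:E).
  by apply/measurable_EFinP; exact: (measurable_funS measurableT).
rewrite -ge0_integralZl//; last 2 first.
- by move=> x _; rewrite lee_fin powR_ge0.
- by rewrite lee_fin powR_ge0.
apply: ge0_le_integral => //.
- by move=> x /pos /= x0; exact: interpolation_integrand_ge0.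
- exact: measurable_interpolation_integrand.
- exact: measurable_funeM.
- move=> x /=; rewrite in_itv/= => /andP[x0 xN].
  have x0' := ltW x0; have p0' := ltW p0.
  rewrite -EFinM lee_fin interpolation_integrandE ?h0//.
  have -> : (1 - beta) * p - 1 = p + (- (beta * p) - 1) by ring.
  rewrite powRD ?(gt_eqF x0) ?implybT// mulrA ler_wpM2r ?powR_ge0//.
  rewrite -powRM// [c * x]mulrC; apply: ge0_ler_powR;
    by rewrite ?nnegrE ?mulr_ge0 ?h0 ?hc.
Qed.

(** The integral is split at [N]. The head estimate involves [k s], which
    [interpolation_integral_ge] converts back into the integral of [k]. *)
Lemma interpolation_integral_le (theta beta C e s N : R) :
  0 < theta -> theta < beta -> beta < 1 -> 0 < C -> 0 < e -> 0 < s -> 0 < N ->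
  (forall t, 0 < t -> h t <= C * k t) ->
  (forall t, 0 < t -> h t <= t * (e * k s)) ->
  (interpolation_integral h beta p <=
    (C `^ p * N `^ (- ((beta - theta) * p)) +
     e `^ p * s `^ (theta * p) * (2 `^ (theta * p + 1) *
       (N `^ ((1 - beta) * p) / ((1 - beta) * p))))%:E *
    interpolation_integral k theta p)%E.
Proof.
move=> th0 tb b1 C0 e0 s0 N0 hk he.
have pos : `]0%R, +oo[ `<=` [set x : R | 0 < x].
  by move=> x/=; rewrite in_itv/= andbT.
have a0 : 0 < (1 - beta) * p by rewrite mulr_gt0 ?subr_gt0.
have E : `]0%R, +oo[%classic = `]0%R, N] `|` `]N, +oo[.
  by rewrite -itv_bndbnd_setU// bnd_simp ltW.
rewrite {1}/interpolation_integral E ge0_integral_setU//; last 3 first.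
- by rewrite -E; exact: measurable_interpolation_integrand.
- by rewrite -E => x /pos /= x0; exact: interpolation_integrand_ge0.
- apply/disj_setPS => x/=; rewrite !in_itv/= andbT => -[/andP[_ xN] Nx].
  by move: (lt_le_trans Nx xN); rewrite ltxx.
rewrite EFinD ge0_muleDl; last 2 first.
- by rewrite lee_fin mulr_ge0 ?powR_ge0.
- by rewrite lee_fin !mulr_ge0 ?powR_ge0 ?invr_ge0// ltW.
rewrite addeC; apply: leeD.
  exact: interpolation_integral_tail.
apply: le_trans (interpolation_integral_head beta (e * k s) N _ _ _ _) _ => //.
  by rewrite mulr_ge0 ?k0 ?ltW.
have ge := interpolation_integral_ge theta s th0 s0.
set M := N `^ _ / _.
have M0 : 0 <= M by rewrite /M divr_ge0 ?powR_ge0 ?ltW.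
(* This constant is chosen so that multiplying the lower bound [ge] by it cancels the powers of [s]
   and 2 exactly, leaving [(e * k s) ^ p * M]. *)
set c := e `^ p * _ * _.
have c0 : (0 <= c%:E)%E.
  by rewrite lee_fin; apply: mulr_ge0; apply: mulr_ge0; rewrite ?powR_ge0.
apply: le_trans (lee_wpmul2l c0 ge); rewrite /c.
rewrite -EFinM lee_fin powRM ?k0 ?(ltW s0) ?(ltW e0)// -opprD !powRN.
have ? : s `^ (theta * p) != 0 by rewrite gt_eqF ?powR_gt0.
have ? : (2 : R) `^ (theta * p + 1) != 0 by rewrite gt_eqF ?powR_gt0.
by rewrite le_eqVlt; apply/orP; left; apply/eqP; field; apply/andP.
Qed.

End Estimates.
End PowerIntegral.

(** * Linear operators and small powers *)

Lemma linear_at0 {K : pzRingType} {V W : lmodType K} (u : V -> W) :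
  linear u -> u 0 = 0.
Proof.
by move=> lu; have := lu (-1) 0 0; rewrite scaler0 addr0 scaleN1r addNr.
Qed.

(** By homogeneity it suffices to normalise [f] into the unit ball; a vector of norm 0 is treated
    apart. *)
Lemma operator_norm_ler {R : realType} {V W : normedModType R[i]} (u : V -> W)
    (e : R) : linear u -> (operator_norm ernorm ernorm u < e%:E)%E ->
  forall f, rnorm (u f) <= e * rnorm f.
Proof.
move=> lu ue f.
have uZ (a : R[i]) (x : V) : u (a *: x) = a *: u x.
  by have := lu a x 0; rewrite addr0 (linear_at0 _ lu) addr0.
have [f0|fn0] := eqVneq (rnorm f) 0.
  by rewrite f0 (rnorm_eq0 _ f0) (linear_at0 _ lu) rnorm0 mulr0.
have fp : 0 < rnorm f by rewrite lt_neqAle eq_sym fn0 rnorm_ge0.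
have iv : 0 <= (rnorm f)^-1 by rewrite invr_ge0 ltW.
have : (ernorm (u ((rnorm f)^-1%:C *: f)) <= e%:E)%E.
  apply: le_trans (ltW ue); apply: ereal_sup_ubound.
  exists ((rnorm f)^-1%:C *: f) => //=.
  by rewrite /ernorm rnormZ// mulVf.
by rewrite lee_fin uZ rnormZ// ler_pdivrMl// mulrC.
Qed.

Lemma powR_small {R : realType} (c q eta : R) : 0 < c -> 0 < q -> 0 < eta ->
  exists2 x : R, 0 < x & c * x `^ q <= eta.
Proof.
move=> c0 q0 eta0; exists ((eta / c) `^ q^-1); first exact/powR_gt0/divr_gt0.
rewrite -powRrM mulVf ?gt_eqF// powRr1 ?divr_ge0 ?(ltW c0) ?(ltW eta0)//.
by rewrite mulrC divfK ?gt_eqF.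
Qed.

(** * Operators acting on interpolation spaces *)

Section Interpolation.
Context {R : realType} {X Y : normedModType R[i]}.
Variables (i : X -> Y) (p : R).
Hypothesis p0 : 0 < p.

Lemma interpolation_norm_le (theta beta B : R) (a b : Y) : 0 <= B ->
  (interpolation_integral (K_functional i b) beta p <=
    B%:E * interpolation_integral (K_functional i a) theta p)%E ->
  (interpolation_norm i beta p b <=
    (B `^ p^-1)%:E * interpolation_norm i theta p a)%E.
Proof.
move=> B0 h.
have I0 (g : Y) (th : R) : (0 <= interpolation_integral (K_functional i g) th p)%E.
  apply: integral_ge0 => t; rewrite /= in_itv/= andbT.
  exact: interpolation_integrand_ge0.
have p'0 : 0 <= p^-1 by rewrite invr_ge0 ltW.
have BE0 : (0 <= B%:E)%E by rewrite lee_fin.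
rewrite -poweR_EFin /interpolation_norm -(poweRM p^-1 BE0 (I0 a theta)).
apply: gt0_ler_poweR => //.
- by rewrite in_itv/= I0 leey.
- by rewrite in_itv/= mule_ge0 ?I0 ?leey.
Qed.

Context {DX : X -> X} {D : Y -> Y} {C e : R}.
Hypotheses (DD : {morph D : x y / x + y}) (iD : forall f, i (DX f) = D (i f))
  (C0 : 0 < C) (e0 : 0 < e)
  (DXC : forall f, rnorm (DX f) <= C * rnorm f)
  (DC : forall f, rnorm (D f) <= C * rnorm f)
  (De : forall f, rnorm (D (i f)) <= e * rnorm f) (i0 : i 0 = 0).

Lemma K_functional_op_le (a : Y) (t : R) : 0 < t ->
  K_functional i (D a) t <= C * K_functional i a t.
Proof.
move=> t0; apply: K_functional_scale_le => // a0 a1 ->.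
apply: le_trans (K_functional_le i _ t (DX a0) (D a1) (ltW t0) _) _.
  by rewrite DD iD.
by rewrite mulrDr lerD// mulrCA ler_wpM2l// ltW.
Qed.

(* Decompose [D a] trivially as [0 + D a] and bound its norm in [Y]. *)
Lemma K_functional_op_small (a : Y) (t : R) : 0 < t ->
  K_functional i (D a) t <= t * (e * K_functional i a (C / e)).
Proof.
move=> t0; rewrite mulrA; apply: K_functional_scale_le => [|a0 a1 ->].
  exact: mulr_gt0.
apply: le_trans (K_functional_le i _ t 0 _ (ltW t0) _) _.
  by rewrite i0 add0r.
rewrite rnorm0 add0r -mulrA ler_wpM2l ?(ltW t0)// DD.
(* The time [C / e] comes from factoring [e] out of [e * rnorm a0 + C * rnorm a1], which bounds the
   norm of [D a]. *)
rewrite mulrDr mulrA (mulrC C) mulVKf ?gt_eqF//.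
by apply: le_trans (ler_rnormD _ _) _; rewrite lerD.
Qed.

(** This serves twice: with [D] the identity it gives boundedness of the injection, and with [D] the
    operator [DeltaY A] it gives smallness for sets of small measure. *)
Lemma interpolation_norm_op_le (theta beta N : R) (a : Y) :
  0 < theta -> theta < beta -> beta < 1 -> 0 < N ->
  (interpolation_norm i beta p (D a) <=
    ((C `^ p * N `^ (- ((beta - theta) * p)) +
      e `^ p * (C / e) `^ (theta * p) * (2 `^ (theta * p + 1) *
        (N `^ ((1 - beta) * p) / ((1 - beta) * p)))) `^ p^-1)%:E *
    interpolation_norm i theta p a)%E.
Proof.
move=> th0 tb b1 N0; have a0 : 0 <= (1 - beta) * p.
  by rewrite mulr_ge0 ?subr_ge0 ?ltW.
apply: interpolation_norm_le.
  by rewrite addr_ge0 ?mulr_ge0 ?powR_ge0 ?invr_ge0.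
apply: interpolation_integral_le; rewrite ?divr_gt0//.
- by move=> t; exact: K_functional_ge0.
- by move=> s t; exact: K_functional_nondecreasing.
- by move=> t; exact: K_functional_ge0.
- by move=> s t; exact: K_functional_nondecreasing.
- by move=> t; exact: K_functional_op_le.
- by move=> t; exact: K_functional_op_small.
Qed.

End Interpolation.

(* With [s = C / e] the head constant is of order [e ^ ((1 - theta) p)]: first
   [N] is taken large, then [e] small. *)
Lemma interpolation_constant_small {R : realType} (theta beta p C eps : R) :
  0 < theta -> theta < beta -> beta < 1 -> 0 < p -> 0 < C -> 0 < eps ->
  exists N e : R, [/\ 0 < N, 0 < e &
    (C `^ p * N `^ (- ((beta - theta) * p)) +
      e `^ p * (C / e) `^ (theta * p) * (2 `^ (theta * p + 1) *
        (N `^ ((1 - beta) * p) / ((1 - beta) * p)))) `^ p^-1 <= eps].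
Proof.
move=> th0 tb b1 p0 C0 eps0.
have a0 : 0 < (1 - beta) * p by rewrite mulr_gt0 ?subr_gt0.
have a0' := ltW a0.
(* Before the [p]-th root is taken, tail and head each receive half of [eps ^ p]. *)
have eta0 : 0 < eps `^ p / 2 by rewrite divr_gt0 ?powR_gt0.
(* The unknown [x] is the inverse of [N], which makes the exponent positive as [powR_small]
   requires. *)
have [x x0 hx] : exists2 x : R, 0 < x &
    C `^ p * x `^ ((beta - theta) * p) <= eps `^ p / 2.
  by apply: powR_small; rewrite ?powR_gt0// mulr_gt0 ?subr_gt0.
pose M := 2 `^ (theta * p + 1) * (x^-1 `^ ((1 - beta) * p) / ((1 - beta) * p)).
have M0 : 0 < M.
  by rewrite /M mulr_gt0 ?powR_gt0// divr_gt0 ?powR_gt0 ?invr_gt0.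
have [e e0 he] : exists2 e : R, 0 < e &
    (C `^ (theta * p) * M) * e `^ ((1 - theta) * p) <= eps `^ p / 2.
  apply: powR_small => //; first exact: mulr_gt0 (powR_gt0 _ C0) M0.
  by rewrite mulr_gt0 ?subr_gt0// (lt_trans tb).
exists x^-1, e; split; rewrite ?invr_gt0//.
have -> : eps = (eps `^ p) `^ p^-1.
  by rewrite -powRrM mulfV ?gt_eqF// powRr1// ltW.
apply: ge0_ler_powR; rewrite ?nnegrE ?powR_ge0 ?invr_ge0 ?(ltW p0)//.
  by rewrite addr_ge0 ?mulr_ge0 ?powR_ge0 ?invr_ge0.
rewrite [leRHS](splitr (eps `^ p)); apply: lerD.
  by rewrite -powR_inv1 ?(ltW x0)// -powRrM mulN1r opprK.
rewrite -/M; apply: le_trans he; rewrite le_eqVlt; apply/orP; left; apply/eqP.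
(* The powers of [e] combine: [e ^ p * (C / e) ^ (theta * p)] equals
   [C ^ (theta * p) * e ^ ((1 - theta) * p)]. *)
have -> : (1 - theta) * p = p - theta * p by ring.
rewrite powRM ?invr_ge0 ?(ltW C0) ?(ltW e0)//.
rewrite -[e^-1]powR_inv1 ?(ltW e0)// -powRrM mulN1r.
by rewrite [e `^ (p - _)]powRD ?(gt_eqF e0) ?implybT//; ring.
Qed.

Theorem proposition12 (R : realType) (d : measure_display)
  (T : measurableType d) (mu : {measure set T -> \bar R})
  (X Y : completeNormedModType R[i])
  (DeltaX : set T -> X -> X) (DeltaY : set T -> Y -> Y) (i : X -> Y)
  (hX : wide_function_space mu DeltaX)
  (hY : wide_function_space mu DeltaY)
  (hi : absolutely_continuous mu ernorm DeltaX ernorm i)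
  (hinj : injective i)
  (hdense : dense (range i))
  (hDelta : forall (A : set T) (f : X), measurable A ->
    i (DeltaX A f) = DeltaY A (i f)) :
  forall theta beta p : R,
    0 < theta -> theta < beta -> beta < 1 -> 1 < p ->
    absolutely_continuous mu
      (interpolation_norm i theta p) DeltaY (interpolation_norm i beta p)
      (idfun : Y -> Y).
Proof.
move=> theta beta p th0 tb b1 p1.
have p0 : 0 < p by apply: lt_trans p1.
have [[li [M iM]] iac] := hi.
have addL (V W : lmodType R[i]) (u : V -> W) : linear u -> {morph u : x y / x + y}.
  by move=> lu x y; have := lu 1 x y; rewrite !scale1r.
have i0 := linear_at0 _ li.
split.
  split; first by move=> a x y.
  (* Boundedness is the case of identity operators with [C = N = 1]. The bound [M] of [i] need not
     be positive, hence the maximum with 1. *)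
  pose e := Num.max M 1.
  have e0 : 0 < e by rewrite /e lt_max ltr01 orbT.
  eexists => f _.
  apply: (@interpolation_norm_op_le _ _ _ i p p0 idfun idfun 1 e
    _ _ _ _ _ _ _ _ theta beta 1 f) => //.
  - by move=> g; rewrite mul1r.
  - by move=> g; rewrite mul1r.
  - move=> g /=; have := iM g (ltry _); rewrite -EFinM lee_fin => /le_trans; apply.
    by rewrite ler_wpM2r ?rnorm_ge0// /e le_max lexx.
move=> eps eps0.
have [CX CX0 hCX] := wfs_bounded hX.
have [CY CY0 hCY] := wfs_bounded hY.
pose C := Num.max CX CY.
have C0 : 0 < C by rewrite /C lt_max CX0.
(* A bound on every element gives only a weak inequality for the supremum, so [eps / 2] is aimed at
   to get a strict one. *)
have eps20 : 0 < eps / 2 by rewrite divr_gt0.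
have [N [e [N0 e0 small]]] :=
  interpolation_constant_small theta beta p C (eps / 2) th0 tb b1 p0 C0 eps20.
(* Since [i] intertwines [DeltaX A] and [DeltaY A], absolute continuity of [i] at level [e] bounds
   [DeltaY A] composed with [i]. *)
have [delta delta0 hdelta] := iac e e0.
exists delta => // A mA Ad.
apply: (@le_lt_trans _ _ (eps / 2)%:E); last by rewrite lte_fin; lra.
have De := @operator_norm_ler R X Y _ e _ (hdelta A mA Ad).
apply: ge_ereal_sup => _ [f /= f1 <-].
apply: le_trans (@interpolation_norm_op_le _ _ _ i p p0 (DeltaX A) (DeltaY A) C e
  _ _ _ _ _ _ _ _ theta beta N f _ _ _ _) _ => //.
- exact/addL/(wfs_linear hY).
- by move=> g; rewrite hDelta.
- move=> g; apply: le_trans (hCX _ _ mA) _.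
  by rewrite ler_wpM2r ?rnorm_ge0// /C le_max lexx.
- move=> g; apply: le_trans (hCY _ _ mA) _.
  by rewrite ler_wpM2r ?rnorm_ge0// /C le_max lexx orbT.
- move=> g; rewrite -hDelta//; apply: De => a x y /=.
  by rewrite (wfs_linear hX) // li.
- rewrite -[leRHS]mule1; apply: lee_pmul => //.
  + by rewrite lee_fin powR_ge0.
  + exact: poweR_ge0.
Qed.
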